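(* Let $(\Sigma, I, \to, \preceq)$ be a well-structured transition system and let $P \subseteq \Sigma$ be a downward-closed set. If the rule system described in the context admits a derivation $\mathsf{Init} \mapsto^{*} \mathsf{valid}$, then $\mathrm{Cover} \subseteq P$.
   Context: A well-structured transition system (WSTS) $(\Sigma, I, \to, \preceq)$ consists of a set $\Sigma$ of states, a finite set $I \subseteq \Sigma$ of initial states, a relation $\to \subseteq \Sigma \times \Sigma$, and a well-quasi-order $\preceq$ on $\Sigma$ such that whenever $s_1 \to s_2$ and $s_1 \preceq t_1$, there is $t_2$ with $t_1 \to^{*} t_2$ and $s_2 \preceq t_2$. For $Y \subseteq \Sigma$, $\uparrow Y = \{x \mid \exists y \in Y,\ y \preceq x\}$ and $\downarrow Y = \{x \mid \exists y \in Y,\ x \preceq y\}$; $\uparrow x = \uparrow\{x\}$. For $X \subseteq \Sigma$, $\mathrm{pre}(X) = \{y \mid \exists x \in X,\ y \to x\}$ and $\mathrm{post}(X) = \{y \mid \exists x \in X,\ x \to y\}$. $\mathrm{Reach}$ is the set of states reachable from $I$ via $\to^{*}$, and $\mathrm{Cover} = \downarrow \mathrm{Reach}$. The rule system (generic version). Its states are $\mathsf{Init}$, $\mathsf{valid}$, $\mathsf{invalid}$, and pairs $\mathbf{R} \mid Q$ where $\mathbf{R} = (R_0, \ldots, R_N)$ ($N \ge 0$, called the length) is a vector of downward-closed subsets of $\Sigma$ and $Q$ is a finite priority queue of pairs $\langle a, i\rangle \in \Sigma \times \mathbb{N}$ with priority $i$; $\min Q$ is an element of least priority, $\mathrm{popMin}(Q)$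 is $Q$ with that element removed, $\mathrm{push}(Q,x)$ is $Q$ with $x$ added. For $0 \le i \le N$ and $a \in \Sigma$ let $\mathrm{Gen}_i(a) = \{ b \mid b \preceq a,\ \uparrow b \cap I = \emptyset,\ \mathrm{pre}(\uparrow b) \cap (R_i \setminus \uparrow b) = \emptyset\}$. $\mathbf{R}[R_k \gets R'_k]_{k=1}^i$ denotes $(R_0, R'_1, \ldots, R'_i, R_{i+1}, \ldots, R_N)$. The one-step relation $\mapsto$ is given by the rules: (Initialize) $\mathsf{Init} \mapsto (\downarrow I) \mid \emptyset$ (a vector of length $0$ with $R_0 = \downarrow I$). (CandidateNondet) if $a \in R_N \setminus P$: $\mathbf{R} \mid \emptyset \mapsto \mathbf{R} \mid \{\langle a, N\rangle\}$. (ModelSyn) if $\min Q = \langle a, 0\rangle$: $\mathbf{R}\mid Q \mapsto \mathsf{invalid}$. (ModelSem) if $\min Q = \langle a, i\rangle$ and $I \cap \uparrow a \neq \emptyset$: $\mathbf{R}\mid Q \mapsto \mathsf{invalid}$. (DecideNondet) if $\min Q = \langle a, i \rangle$, $i > 0$, $b \in \mathrm{pre}(\uparrow a) \cap (R_{i-1} \setminus \uparrow a)$: $\mathbf{R}\mid Q \mapsto \mathbf{R} \mid \mathrm{push}(Q, \langle b, i-1\rangle)$. (Conflict) if $\min Q = \langle a, i\rangle$, $i>0$, $\mathrm{pre}(\uparrow a) \cap (R_{i-1}\setminus \uparrow a) = \emptyset$ and $b \in \mathrm{Gen}_{i-1}(a)$: $\mathbf{R}\mid Q \mapsto \mathbf{R}[R_k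 \gets R_k \setminus \uparrow b]_{k=1}^{i} \mid \mathrm{popMin}(Q)$. (Induction) if $R_i = \Sigma \setminus \uparrow\{r_{i,1}, \ldots, r_{i,m}\}$ and $b \in \mathrm{Gen}_i(r_{i,j})$ for some $1 \le j \le m$: $\mathbf{R} \mid \emptyset \mapsto \mathbf{R}[R_k \gets R_k \setminus \uparrow b]_{k=1}^{i+1} \mid \emptyset$. (Valid) if $R_i = R_{i+1}$ for some $i < N$: $\mathbf{R}\mid Q \mapsto \mathsf{valid}$. (Unfold) if $R_N \subseteq P$: $\mathbf{R} \mid \emptyset \mapsto (R_0, \ldots, R_N, \Sigma) \mid \emptyset$. $\mapsto^{*}$ is the reflexive-transitive closure of $\mapsto$. *)

(* Defs.v *)
From mathcomp Require Import all_boot all_classical.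
From Stdlib Require Import Relations.
From Stdlib Require List.

Set Implicit Arguments.
Unset Strict Implicit.
Unset Printing Implicit Defensive.

Local Open Scope classical_set_scope.

Definition wqo (T : Type) (le : relation T) : Prop :=
  Relation_Definitions.preorder T le /\
  forall f : nat -> T, exists i j : nat, i < j /\ le (f i) (f j).

(* Compatibility is the weak one: a step is matched by any number of steps. *)
Record wsts : Type := Wsts {
  wstate :> Type;
  winit : set wstate;
  wtrans : relation wstate;
  wle : relation wstate;
  winit_finite : finite_set winit;
  wle_wqo : wqo wle;
  wcompat : forall s1 s2 t1 : wstate, wtrans s1 s2 -> wle s1 t1 ->
    exists2 t2 : wstate, clos_refl_trans wstate wtrans t1 t2 & wle s2 t2
}.

Definition up (S : wsts) (Y : set S) : set S :=
  [set x | exists2 y, Y y & wle y x].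

Definition down (S : wsts) (Y : set S) : set S :=
  [set x | exists2 y, Y y & wle x y].

Definition down_closed (S : wsts) (Y : set S) : Prop :=
  forall x y : S, Y y -> wle x y -> Y x.

Definition pre (S : wsts) (X : set S) : set S :=
  [set y | exists2 x, X x & wtrans y x].

Definition Reach (S : wsts) : set S :=
  [set x | exists2 s, winit s & clos_refl_trans S (@wtrans S) s x].

Definition Cover (S : wsts) : set S := down (@Reach S).

Record downset (S : wsts) : Type := Downset {
  dset :> set S;
  dset_down_closed : down_closed dset
}.

Lemma down_down_closed (S : wsts) (Y : set S) : down_closed (down Y).
Proof.
case: (@wle_wqo S) => -[_ tr] _ x y [z Yz yz] xy.
by exists z => //; apply: tr xy yz.
Qed.

Lemma setD_up_down_closed (S : wsts) (D : downset S) (b : S) :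
  down_closed (D `\` up [set b]).
Proof.
case: (@wle_wqo S) => -[_ tr] _ x y [Dy nby] xy; split.
  exact: dset_down_closed Dy xy.
by move=> [_ -> bx]; apply: nby; exists b => //; apply: tr bx xy.
Qed.

Lemma setT_down_closed (S : wsts) : down_closed [set: S].
Proof. by []. Qed.

Definition down_init (S : wsts) : downset S :=
  Downset (@down_down_closed S (@winit S)).

Definition remove_up (S : wsts) (D : downset S) (b : S) : downset S :=
  Downset (@setD_up_down_closed S D b).

Definition full_downset (S : wsts) : downset S :=
  Downset (@setT_down_closed S).

(* A vector (R_0, ..., R_N) of length N; it has N + 1 entries. *)
Definition frames (S : wsts) (N : nat) : Type := 'I_N.+1 -> downset S.

(* R[R_k <- R_k \ up b]_{k=1}^i ; entry 0 is never modified. *)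
Definition block (S : wsts) (N : nat) (R : frames S N) (i : nat) (b : S) :
    frames S N :=
  fun k => if 1 <= k <= i then remove_up (R k) b else R k.

(* (R_0, ..., R_N, Sigma) *)
Definition extend (S : wsts) (N : nat) (R : frames S N) : frames S N.+1 :=
  fun k => if unlift ord_max k is Some j then R j else full_downset S.

(* Gen_i(a) depends on i only through the set R_i, passed here as D. *)
Definition Gen (S : wsts) (D : set S) (a : S) : set S :=
  [set b | [/\ wle b a,
               up [set b] `&` @winit S = set0 &
               pre (up [set b]) `&` (D `\` up [set b]) = set0]].

(* Priority queues are finite lists; their order is irrelevant, as min may be
   any entry of least priority. *)
Definition queue (S : wsts) : Type := seq (S * nat).

Definition is_min (S : wsts) (Q : queue S) (x : S * nat) : Prop :=
  List.In x Q /\ forall y, List.In y Q -> x.2 <= y.2.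

(* min Q = x and popMin Q = Q'. *)
Definition is_pop_min (S : wsts) (Q : queue S) (x : S * nat) (Q' : queue S) :
    Prop :=
  is_min Q x /\ exists Q1 Q2 : queue S, Q = Q1 ++ x :: Q2 /\ Q' = Q1 ++ Q2.

Inductive config (S : wsts) : Type :=
  | Init
  | Valid
  | Invalid
  | Run (N : nat) (R : frames S N) (Q : queue S).

Arguments Init {S}.
Arguments Valid {S}.
Arguments Invalid {S}.

(* Every use of inord below is within bounds.  The strict bound on i in
   step_induction is what makes the updated entries 1, ..., i + 1 exist. *)
Inductive step (S : wsts) (P : set S) : config S -> config S -> Prop :=
  | step_initialize :
      step P Init (Run (fun _ : 'I_1 => down_init S) [::])
  | step_candidate_nondet N (R : frames S N) (a : S) :
      (R ord_max `\` P) a ->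
      step P (Run R [::]) (Run R [:: (a, N)])
  | step_model_syn N (R : frames S N) (Q : queue S) (a : S) :
      is_min Q (a, 0) ->
      step P (Run R Q) Invalid
  | step_model_sem N (R : frames S N) (Q : queue S) (a : S) (i : nat) :
      is_min Q (a, i) ->
      @winit S `&` up [set a] !=set0 ->
      step P (Run R Q) Invalid
  | step_decide_nondet N (R : frames S N) (Q : queue S) (a b : S)
        (i : 'I_N.+1) :
      is_min Q (a, val i) ->
      0 < i ->
      (pre (up [set a]) `&` (R (inord i.-1) `\` up [set a])) b ->
      step P (Run R Q) (Run R ((b, i.-1) :: Q))
  | step_conflict N (R : frames S N) (Q Q' : queue S) (a b : S)
        (i : 'I_N.+1) :
      is_pop_min Q (a, val i) Q' ->
      0 < i ->
      pre (up [set a]) `&` (R (inord i.-1) `\` up [set a]) = set0 ->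
      Gen (R (inord i.-1)) a b ->
      step P (Run R Q) (Run (block R i b) Q')
  | step_induction N (R : frames S N) (i : 'I_N.+1) (m : nat) (r : 'I_m -> S)
        (j : 'I_m) (b : S) :
      i < N ->
      R i = ~` up (range r) :> set S ->
      Gen (R i) (r j) b ->
      step P (Run R [::]) (Run (block R i.+1 b) [::])
  | step_valid N (R : frames S N) (Q : queue S) (i : 'I_N.+1) :
      i < N ->
      R i = R (inord i.+1) :> set S ->
      step P (Run R Q) Valid
  | step_unfold N (R : frames S N) :
      R ord_max `<=` P ->
      step P (Run R [::]) (Run (extend R) [::]).

Definition steps (S : wsts) (P : set S) : config S -> config S -> Prop :=
  clos_refl_trans (config S) (step P).

(* Main.v *)
(** As in IC3, every reachable [R | Q] keeps its frames increasing, starts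
    them at the downward closure of [I], has the [post] of each frame contained
    in the next one, and has all frames but the last contained in [P].  When
    two consecutive frames coincide, that frame is therefore an inductive
    downward-closed invariant inside [P], so it contains [Cover].  Removing
    [up b] preserves the invariant: elements of [Gen] are chosen so that
    [up b] is disjoint from [I] and has no predecessor outside [up b] in the
    relevant frame. *)
Require Import Defs.
From mathcomp Require Import all_boot all_classical.
Local Open Scope classical_set_scope.

Set Implicit Arguments.
Unset Strict Implicit.
Unset Printing Implicit Defensive.

Record frames_inv (S : wsts) (P : set S) (N : nat) (R : frames S N) : Prop :=
  FramesInv {
    frame0 : forall i : 'I_N.+1, i = 0 :> nat ->
      R i = Defs.down (@winit S) :> set S;
    frame_mono : forall i j : 'I_N.+1, i <= j -> R i `<=` R j;
    frame_post : forall (i j : 'I_N.+1) (x y : S), j = i.+1 :> nat ->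
      dset (R i) x -> wtrans x y -> dset (R j) y;
    frame_safe : forall i : 'I_N.+1, i < N -> R i `<=` P
  }.

(** At [Valid] the invariant is the desired conclusion itself, so the theorem reduces to
    preservation along a derivation. *)
Definition config_inv (S : wsts) (P : set S) (c : config S) : Prop :=
  match c with
  | Run _ R _ => frames_inv P R
  | Valid => @Cover S `<=` P
  | _ => True
  end.

Lemma Gen_disjoint_down_init (S : wsts) (D : set S) (a b x : S) :
  Gen D a b -> Defs.down (@winit S) x -> ~ up [set b] x.
Proof.
case: (@wle_wqo S) => -[_ tr] _ [_ bI _] [s Is xs] [_ -> bx].
have : (up [set b] `&` @winit S) s.
  by split => //; exists b => //; apply: tr bx xs.
by rewrite bI.
Qed.

Lemma Gen_pre_up (S : wsts) (D : set S) (a b x y : S) :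
  Gen D a b -> D x -> wtrans x y -> up [set b] y -> up [set b] x.
Proof.
move=> [_ _ preb] Dx xy by_; apply: contrapT => nbx.
have : (pre (up [set b]) `&` (D `\` up [set b])) x by split=> //; exists y.
by rewrite preb.
Qed.

Lemma block_sub (S : wsts) (N : nat) (R : frames S N) (i : nat) (b : S)
    (k : 'I_N.+1) :
  block R i b k `<=` R k.
Proof. by rewrite /block; case: ifP => _ x //= []. Qed.

Lemma mem_block (S : wsts) (N : nat) (R : frames S N) (i : nat) (b x : S)
    (k : 'I_N.+1) :
  dset (R k) x -> (1 <= k <= i -> ~ up [set b] x) -> dset (block R i b k) x.
Proof. by rewrite /block; case: ifP => // _ Rx nb; split=> //; apply: nb. Qed.

(** [block] leaves frame 0 alone, but that frame is the downward closure of the initial states,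
    which [Gen] already keeps disjoint from [up [set b]]. *)
Lemma block_avoids (S : wsts) (P : set S) (N : nat) (R : frames S N)
    (d k : 'I_N.+1) (a b x : S) :
  frames_inv P R -> Gen (R d) a b -> k <= d.+1 ->
  dset (block R d.+1 b k) x -> ~ up [set b] x.
Proof.
move=> inv gen kd; rewrite /block kd andbT; case: ifPn => [_ []//|].
rewrite -eqn0Ngt => /eqP k0; rewrite (frame0 inv k0).
exact: Gen_disjoint_down_init gen.
Qed.

(** Serves both Conflict, with [d = i - 1], and Induction, with [d = i]. *)
Lemma block_inv (S : wsts) (P : set S) (N : nat) (R : frames S N)
    (d : 'I_N.+1) (a b : S) :
  frames_inv P R -> Gen (R d) a b -> frames_inv P (block R d.+1 b).
Proof.
move=> inv gen; split.
- by move=> i i0; rewrite /block i0; apply: (frame0 inv).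
- move=> i j ij x Rx; apply: mem_block.
    by apply: (frame_mono inv ij); apply: block_sub Rx.
  move=> /andP[_ jd]; apply: (block_avoids inv gen _ Rx).
  exact: leq_trans jd.
- move=> i j x y ji Rx xy; have Rix := block_sub Rx.
  apply: mem_block; first exact: (frame_post inv ji Rix xy).
  (* Since [i <= d], [x] lies in [R d]; were [y] above [b], [Gen] would put [x] above [b] too, which
     [block_avoids] excludes. *)
  rewrite ji => /andP[_ id_].
  move=> /(Gen_pre_up gen (frame_mono inv id_ Rix) xy).
  by apply: (block_avoids inv gen _ Rx); apply: ltnW.
- move=> i iN x Rx; apply: (frame_safe inv iN).
  exact: block_sub Rx.
Qed.

Lemma extend_inv (S : wsts) (P : set S) (N : nat) (R : frames S N) :
  frames_inv P R -> R ord_max `<=` P -> frames_inv P (extend R).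
Proof.
move=> inv RP; split; rewrite /extend.
- move=> i; case: unliftP => [k ->|->] //.
  by rewrite lift_max; apply: (frame0 inv).
- move=> i j; case: (unliftP _ j) => [l ->|->] //.
  case: unliftP => [k ->|->]; rewrite !lift_max.
    exact: (frame_mono inv).
  by rewrite /= leqNgt ltn_ord.
- move=> i j x y; case: (unliftP _ j) => [l ->|->] //.
  case: unliftP => [k ->|->]; rewrite !lift_max.
    exact: (frame_post inv).
  by move=> /= lN; have := ltn_ord l; rewrite lN ltnNge leqnSn.
- move=> i; case: unliftP => [k ->|->]; last by rewrite ltnn.
  (* The guard of Unfold makes the old last frame safe, and it contains all earlier ones. *)
  move=> _ x Rx; apply: RP; apply: (frame_mono inv) Rx.
  exact: leq_ord.
Qed.

Lemma inductive_Reach (S : wsts) (D : set S) :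
  @winit S `<=` D -> (forall x y, D x -> wtrans x y -> D y) ->
  @Reach S `<=` D.
Proof.
move=> ID postD x [s /ID Ds sx].
by elim: sx Ds => // [y z yz Dy|y z t _ IHy _ IHz /IHy/IHz //]; apply: postD yz.
Qed.

Lemma step_inv (S : wsts) (P : set S) (c c' : config S) :
  down_closed P -> step P c c' -> config_inv P c -> config_inv P c'.
Proof.
move=> hP; case=> //=.
- split=> [//|i j _ x //|i j x y ji|//]; by have := ltn_ord j; rewrite ji.
- move=> N R Q Q' a b i _ i0 _ gen inv.
  have iE : i = (inord i.-1 : 'I_N.+1).+1 :> nat.
    by rewrite inordK ?prednK // (leq_trans _ (ltn_ord i)) // ltnS leq_pred.
  by rewrite iE; apply: block_inv inv gen.
- by move=> N R i m r j b _ _ gen inv; apply: block_inv inv gen.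
- move=> N R _ i iN RiE inv x [y yR xy]; apply: hP xy.
  apply: (frame_safe inv iN); move: y yR; apply: inductive_Reach.
    move=> s Is; apply: (frame_mono inv (i := ord0)) => //.
    rewrite (frame0 inv) //; exists s => //.
    by case: (@wle_wqo S) => -[+ _] _; apply.
  (* Equality of the two frames turns [frame_post] into inductiveness of [R i]. *)
  move=> y z Ry yz; rewrite RiE; apply: (frame_post inv) Ry yz.
  by rewrite inordK.
- by move=> N R RP inv; apply: extend_inv.
Qed.

Theorem theorem1 (S : wsts) (P : set S) (hP : down_closed P)
    (hvalid : steps P Init Valid) :
  @Cover S `<=` P.
Proof.
suff: config_inv P Init -> config_inv P Valid by apply.
elim: hvalid => [c c' cc'|//|c c' c'' _ IH _ IH' /IH/IH' //].
exact: step_inv cc'.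
Qed.
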